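(* Assume that $X[\mathcal{T}]$ is a locally convex topological vector space whose topology is generated by a filtering family of seminorms $\langle\|\cdot\|_i\rangle_{i\in I}$; $|||\cdot|||$ is a seminorm on $X$ that is $\mathcal{T}$-lower-semicontinuous; $\langle X_k\rangle_{k\in\mathbb{N}}$ is a non-decreasing sequence of $\mathcal{T}$-closed vector subspaces whose union is $X$; $C_k=X_k\cap\{x:|||x|||\le k\}$ for each $k\in\mathbb{N}$; and $\mathcal{C}=\{C_k:k\in\mathbb{N}\}$. Then for every linear function $f:X\to\mathbb{R}$ the following are equivalent. (a) $f$ is $\mathcal{T}_{\mathcal{C}}$-continuous. (b) For every $\varepsilon>0$ there exist $i\in I$ and $\delta>0$ such that for all $x\in X_{\lceil\varepsilon^{-1}\rceil}$: if $\|x\|_i\le\delta$ and $|||x|||\le\varepsilon^{-1}$ then $|f(x)|\le\varepsilon$. (c) For every $\varepsilon>0$ there exist $i\in I$ and $\theta>0$ such that for all $x\in X_{\lceil\varepsilon^{-1}\rceil}$: $|f(x)|\le\theta\|x\|_i+\varepsilon|||x|||$.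
   Context: All vector spaces are real; topological vector spaces are Hausdorff. $X[\mathcal{T}]$ denotes $X$ equipped with the topology $\mathcal{T}$; $\mathcal{T}|_C=\{E\cap C:E\in\mathcal{T}\}$. A family of seminorms generates a locally convex topology in the usual way (it is separating, and finite intersections of closed seminorm balls centred at $0$ form a local base); it is filtering if for all $i_1,\dots,i_N\in I$ there is $i\in I$ with $\max_n\|\cdot\|_{i_n}\le\|\cdot\|_i$. A localizing family in $X$ is a non-empty collection $\mathcal{C}$ of convex subsets of $X$ containing $0$ such that for all $C\in\mathcal{C}$, $x\in X$, $t\in\mathbb{R}$ there is $D\in\mathcal{C}$ with $x+t\cdot C\subseteq D$ (the family of the claim is one). The localization $\mathcal{T}_{\mathcal{C}}$ is the locally convex vector topology on $X$ consisting of all $E\subseteq X$ such that for every $x\in E$ there is a convex $V$ with $x\in V\subseteq E$ and $V\cap C\in\mathcal{T}|_C$ for every $C\in\mathcal{C}$. *)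

(* Defs.v *)
From HB Require Import structures.
From mathcomp Require Import all_boot all_order all_algebra.
From mathcomp Require Import all_classical all_reals all_analysis.

Set Implicit Arguments.
Unset Strict Implicit.
Unset Printing Implicit Defensive.

Import Order.TTheory GRing.Theory Num.Theory.
Import numFieldTopology.Exports numFieldNormedType.Exports.

Local Open Scope classical_set_scope.
Local Open Scope ring_scope.

Definition seminorm (R : numDomainType) (X : lmodType R) (p : X -> R) :=
  (forall x y, p (x + y) <= p x + p y) /\
  (forall a x, p (a *: x) = `|a| * p x).

(* The empty intersection (D = set0) is X itself; the radii may differ from one
   seminorm to another. *)
Definition generated_by_seminorms (R : realType) (X : tvsType R) (I : Type)
    (p : I -> X -> R) :=
  [/\ forall i, seminorm (p i),
      forall x, (forall i, p i x = 0) -> x = 0 &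
      nbhs (0 : X) =
      filter_from [set D : set (I * R) |
                     finite_set D /\ forall d, D d -> 0 < d.2]
                  (fun D => \bigcap_(d in D) [set x | p d.1 x <= d.2])].

(* The case n = 0 says that I is not empty. *)
Definition filtering (R : realType) (X : Type) (I : Type) (p : I -> X -> R) :=
  forall (n : nat) (j : 'I_n -> I),
    exists i, forall x, \big[Num.max/0]_(k < n) p (j k) x <= p i x.

Definition localizing_family (R : numDomainType) (X : lmodType R)
    (C : set (set X)) :=
  [/\ C !=set0,
      forall A, C A -> convex_set A /\ A 0 &
      forall A x t, C A -> exists2 B, C B & [set x + t *: y | y in A] `<=` B].

Definition relatively_open (X : topologicalType) (C A : set X) :=
  exists2 U, open U & A = U `&` C.

Definition localized_open (R : numDomainType) (X : tvsType R)
    (C : set (set X)) (E : set X) :=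
  forall x, E x -> exists V : set X,
    [/\ convex_set V, V x, V `<=` E &
        forall A, C A -> relatively_open A (V `&` A)].

(* An alias of X that carries the topology localized_open C in place of the
   original topology of X. *)
Definition localization (R : numDomainType) (X : tvsType R)
  (C : set (set X)) : Type := X.

Section localization.
Context (R : numDomainType) (X : tvsType R) (C : set (set X)).

HB.instance Definition _ := GRing.Lmodule.on (localization C).

Let localized_openT : localized_open C setT.
Proof.
move=> x _; exists setT; split => // A _.
by exists setT => //; exact: openT.
Qed.

Let localized_openI : setI_closed (localized_open C).
Proof.
move=> E F oE oF x [/oE[V [cV Vx VE hV]] /oF[W [cW Wx WF hW]]].
exists (V `&` W); split => //.
- move=> a b l; rewrite !in_setI => /andP[aV aW] /andP[bV bW].
  by rewrite (cV _ _ _ aV bV) (cW _ _ _ aW bW).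
- exact: setISS.
- move=> A CA; have [U oU VU] := hV _ CA; have [U' oU' WU'] := hW _ CA.
  by exists (U `&` U'); [exact: openI|rewrite setIIl VU WU' -setIIl].
Qed.

Let localized_open_bigU (I : Type) (f : I -> set X) :
  (forall i, localized_open C (f i)) -> localized_open C (\bigcup_i f i).
Proof.
move=> of_ x [i _ /of_[V [cV Vx Vf hV]]].
by exists V; split => // y /Vf fy; exists i.
Qed.

HB.instance Definition _ := isOpenTopological.Build (localization C)
  localized_openT localized_openI localized_open_bigU.

Lemma localization_openE : (@open (localization C)) = localized_open C.
Proof. by []. Qed.

End localization.

Definition truncations (R : realType) (X : lmodType R) (Xs : nat -> set X)
    (q : X -> R) : set (set X) :=
  range (fun k : nat => Xs k `&` [set x | q x <= k%:R]).

Lemma truncations_localizing (R : realType) (X : lmodType R)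
    (Xs : nat -> set X) (q : X -> R) :
  seminorm q -> nondecreasing_seq Xs -> (forall k, submod_closed [in Xs k]) ->
  \bigcup_k Xs k = setT -> localizing_family (truncations Xs q).
Proof.
move=> [qD qZ] ndX sX cX.
have q0 : q 0 = 0 by rewrite -(scale0r 0) qZ normr0 mul0r.
have XsL k a x y : Xs k x -> Xs k y -> Xs k (a *: x + y).
  move=> /mem_set xk /mem_set yk; apply/set_mem.
  by have [_] := sX k; exact.
have XsZ k a x : Xs k x -> Xs k (a *: x).
  move=> xk; rewrite -[_ *: _]addr0; apply: XsL => //.
  by have [/set_mem] := sX k.
split; first by exists (Xs 0%N `&` [set x | q x <= 0%:R]), 0%N.
  move=> _ [k _ <-]; split; last first.
    by split; [have [/set_mem] := sX k|rewrite /= q0 ler0n].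
  move=> x y l /set_mem[xk qx] /set_mem[yk qy]; apply/mem_set; split.
    exact: (XsL _ _ _ _ xk (XsZ _ _ _ yk)).
  rewrite /= (le_trans (qD _ _))// !qZ.
  have l1 : `|l%:num| + `|(1 - l%:num)%R| = 1.
    by rewrite !ger0_norm ?subr_ge0// addrC subrK.
  rewrite (_ : k%:R =
           `|l%:num| * k%:R + `|(1 - l%:num)%R| * k%:R).
    by rewrite lerD// ler_wpM2l.
  by rewrite -mulrDl l1 mul1r.
move=> _ x t [k _ <-].
have [j _ xj] : (\bigcup_k Xs k) x by rewrite cX.
pose n := maxn (maxn j k) (Num.truncn (q x + `|t| * k%:R)).+1.
have XsS m : (m <= n)%N -> Xs m `<=` Xs n.
  by move=> /ndX; rewrite subsetEset.
exists (Xs n `&` [set x | q x <= n%:R]); first by exists n.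
move=> _ [y [yk qy] <-]; split.
  rewrite addrC; apply: XsL.
    by apply: (XsS k) => //; rewrite /n !leq_max leqnn orbT.
  by apply: (XsS j) => //; rewrite /n !leq_max leqnn.
rewrite /= (le_trans (qD _ _))// qZ.
have h : q x + `|t| * q y <= q x + `|t| * k%:R by rewrite lerD2l ler_wpM2l.
rewrite (le_trans h)// (le_trans (ltW (truncnS_gt _)))// ler_nat.
by rewrite /n leq_max leqnn orbT.
Qed.

(* Main.v *)
Require Import Defs.
From HB Require Import structures.
From mathcomp Require Import all_boot all_order all_algebra.
From mathcomp Require Import all_classical all_reals all_analysis.
From mathcomp Require Import lra.

Set Implicit Arguments.
Unset Strict Implicit.
Unset Printing Implicit Defensive.

Import Order.TTheory GRing.Theory Num.Theory.
Import numFieldTopology.Exports numFieldNormedType.Exports.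

Local Open Scope classical_set_scope.
Local Open Scope ring_scope.

(** For (a) => (b), restrict a convex [T_C]-neighbourhood of 0 inside
    [{|f| < eps}] to a single [C_n] with [eps^-1 <= n]. For (b) => (c), apply (b)
    with [e = min 1 eps] to [x] divided by [p x / delta + e q x + eta], and let
    [eta] tend to 0; homogeneity gives [|f x| <= (e / delta) p x + e^2 q x].
    For (c) => (a), the difference of two points of [C_k] lies in [X_k] and has
    [q]-value at most [2 k], so (c) with a small [eps] shows that [f] is
    [T]-continuous on every [C_k]; the convex sets required by the localization
    are then the preimages of balls. *)

Lemma seminorm_ge0 (R : numDomainType) (X : lmodType R) (p : X -> R) :
  seminorm p -> forall x, 0 <= p x.
Proof.
move=> [pD pZ] x.
have := pD x (-1 *: x).
rewrite scaleN1r subrr -(scale0r 0) pZ normr0 mul0r -scaleN1r pZ normrN1 mul1r.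
by rewrite -mulr2n pmulrn_lge0.
Qed.

Lemma le_absz_ceil (R : archiRealDomainType) (x : R) :
  0 <= x -> x <= (`|Num.ceil x|%N)%:R.
Proof.
move=> x0; rewrite (le_trans (ceil_ge x))// natr_absz.
by rewrite ger0_norm// ceil_ge0 (lt_le_trans _ x0)// ltrN10.
Qed.

Lemma absz_ceil_le (R : archiRealDomainType) (x y : R) :
  0 <= x -> x <= y -> (`|Num.ceil x| <= `|Num.ceil y|)%N.
Proof.
move=> x0 xy; have N1 z : 0 <= z -> -1 < z by apply: lt_le_trans; rewrite ltrN10.
by rewrite -lez_nat !gez0_abs ?ceil_ge0 ?N1 ?le_ceil// (le_trans x0).
Qed.

Lemma submod_closedB_set (R : pzRingType) (X : lmodType R) (A : set X) x y :
  submod_closed [in A] -> A x -> A y -> A (x - y).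
Proof.
move=> [_ AL] /mem_set Ax /mem_set Ay; apply/set_mem.
by rewrite addrC -scaleN1r; exact: AL.
Qed.

Lemma submod_closedZ_set (R : pzRingType) (X : lmodType R) (A : set X) a x :
  submod_closed [in A] -> A x -> A (a *: x).
Proof.
move=> [A0 AL] /mem_set Ax; apply/set_mem.
by rewrite -[_ *: _]addr0; exact: AL.
Qed.

(** A neighbourhood of 0 contains a finite intersection of seminorm balls. Filtering dominates the
    seminorms involved by a single [p i], and the smallest of the radii serves as [delta]. *)
Lemma filtering_base (R : realType) (X : tvsType R) (I : Type)
    (p : I -> X -> R) (U : set X) :
  generated_by_seminorms p -> filtering p -> nbhs (0 : X) U ->
  exists i, exists2 delta : R, 0 < delta & forall x, p i x <= delta -> U x.
Proof.
move=> [_ _ ->] p_filt [D [/finite_setP[n] /card_set_bijP[h [hD h_inj h_surj]] D0] DU].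
(* [g] inverts the enumeration [h] of [D], so that [filtering] can be applied to a family indexed by
   ['I_n]. *)
have /choice[g gP] (k : 'I_n) : exists d, D d /\ h d = k.
  by have [d Dd dk] := h_surj k (ltn_ord k); exists d.
have [i pi] := p_filt n (fun k => (g k).1).
(* The default value 1 keeps the radius positive when [D] is empty. *)
exists i, (\big[Num.min/1]_(k < n) (g k).2).
  by apply: lt_bigmin => // k _; apply: D0; have [] := gP k.
move=> x pix; apply: DU => d Dd /=.
have hdn : (h d < n)%N by exact: hD.
have [Dg hg] := gP (Ordinal hdn).
have {Dg hg} <- : g (Ordinal hdn) = d by apply: h_inj; rewrite ?inE.
apply: le_trans (le_trans (pi x) (le_trans pix _)).
  exact: (le_bigmax _ (fun k => p (g k).1 x) (Ordinal hdn)).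
exact: (bigmin_le _ (Ordinal hdn) (fun k => (g k).2)).
Qed.

Lemma seminorm_ball_nbhs (R : realType) (X : tvsType R) (I : Type)
    (p : I -> X -> R) i (delta : R) (x : X) :
  generated_by_seminorms p -> 0 < delta ->
  nbhs x [set z | p i (z - x) <= delta].
Proof.
move=> [_ _ p_base] delta0.
have /(nbhsT x) : nbhs (0 : X) [set z | p i z <= delta].
  rewrite p_base; exists [set (i, delta)].
    by split; [exact: finite_set1|move=> _ ->].
  by move=> z /(_ (i, delta)); exact.
by apply: filterS => _ [z pz <-] /=; rewrite addrAC subrr add0r.
Qed.

Lemma preimage_ball_convex (R : realType) (X : lmodType R)
    (f : {linear X -> R^o}) (y r : R) :
  convex_set (f @^-1` ball (y : R^o) r).
Proof.
apply/convex_setW => a b; rewrite !inE /= /ball /= => ya yb l l0.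
rewrite -subr_gt0 inE /= => l1.
rewrite [f _](_ : _ = l%:num * f a + (1 - l%:num) * f b); last first.
  by rewrite linearD !linearZ.
move: ya yb; rewrite !ltr_norml => /andP[? ?] /andP[? ?].
by apply/andP; split; nra.
Qed.

(** The set [[set z | C z -> V z]] is the union of [V] and the complement of [C]. It has the same
    trace on [C] as [V], and its interior still contains every point of that trace. *)
Lemma relatively_open_nbhs (X : topologicalType) (C V : set X) :
  (forall x, V x -> C x -> nbhs x [set z | C z -> V z]) ->
  relatively_open C (V `&` C).
Proof.
move=> VC; exists [set z | C z -> V z]°; first exact: open_interior.
apply/seteqP; split=> x [Vx Cx]; split=> //; first exact: VC.
exact: (interior_subset Vx).
Qed.

Lemma localized_continuous_bound (R : realType) (X : tvsType R) (I : Type)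
    (p : I -> X -> R) (q : X -> R) (Xs : nat -> set X)
    (f : {linear X -> R^o}) :
  generated_by_seminorms p -> filtering p -> seminorm q ->
  (forall k, submod_closed [in Xs k]) ->
  continuous (f : localization (truncations Xs q) -> R^o) ->
  forall eps : R, 0 < eps -> exists i, exists2 delta : R, 0 < delta &
    forall x, Xs `|Num.ceil eps^-1|%N x ->
      p i x <= delta -> q x <= eps^-1 -> `|f x| <= eps.
Proof.
move=> p_gen p_filt [_ qZ] Xs_sub /continuousP fC eps eps0.
have oE := fC _ (ball_open (0 : R^o) eps).
rewrite localization_openE in oE.
have [|V [_ V0 VE V_open]] := oE 0.
  by rewrite /= linear0; exact: ballxx.
set n := `|Num.ceil eps^-1|%N.
(* Since [eps^-1 <= n], every point of [Xs n] with [q x <= eps^-1] lies in the truncation of index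
   [n], on which [V] agrees with the open set [U]. *)
have [U oU VU] := V_open _ (imageT _ n).
have U0 : nbhs (0 : X) U.
  apply: open_nbhs_nbhs; split=> //.
  suff [] : (U `&` (Xs n `&` [set x | q x <= n%:R])) 0 by [].
  rewrite -VU; split=> //; split.
    by have [/set_mem] := Xs_sub n.
  by rewrite /= -(scale0r 0) qZ normr0 mul0r.
have [i [delta delta0 pU]] := filtering_base p_gen p_filt U0.
exists i, delta => // x Xx px qx.
have : (V `&` (Xs n `&` [set x | q x <= n%:R])) x.
  rewrite VU; split; first exact: pU.
  split=> //; apply: le_trans qx _.
  by apply: le_absz_ceil; rewrite invr_ge0 ltW.
by move=> [/VE + _]; rewrite /= /ball /= sub0r normrN => /ltW.
Qed.

Lemma homogeneous_bound (R : realType) (X : lmodType R) (p q : X -> R)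
    (A : set X) (f : {linear X -> R^o}) (e delta : R) :
  seminorm p -> seminorm q -> submod_closed [in A] ->
  0 < e -> e <= 1 -> 0 < delta ->
  (forall x, A x -> p x <= delta -> q x <= e^-1 -> `|f x| <= e) ->
  forall x, A x -> `|f x| <= e / delta * p x + e * q x.
Proof.
move=> p_semi q_semi A_sub e0 e1 delta0 fA x Ax.
have px := seminorm_ge0 p_semi x; have qx := seminorm_ge0 q_semi x.
apply/ler_addgt0Pr => eta eta0.
(* The first two terms bring [t^-1 *: x] within the bounds [delta] on [p] and [e^-1] on [q]; [eta]
   keeps [t] positive when [p x] and [q x] both vanish. *)
set t := p x / delta + e * q x + eta.
have pd0 : 0 <= p x / delta by rewrite divr_ge0// ltW.
have eq0 : 0 <= e * q x by rewrite mulr_ge0// ltW.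
have t0 : 0 < t by rewrite /t; lra.
have nt : `|t^-1| = t^-1 by rewrite gtr0_norm// invr_gt0.
have : `|f (t^-1 *: x)| <= e.
  apply: fA; first exact: submod_closedZ_set.
    rewrite p_semi.2 nt mulrC ler_pdivrMr// mulrC -ler_pdivrMr//.
    by rewrite /t; lra.
  rewrite q_semi.2 nt mulrC ler_pdivrMr// mulrC ler_pdivlMr// mulrC.
  by rewrite /t; lra.
(* This leaves the comparison of [e * t] with the claimed bound, where [e <= 1] absorbs the extra
   factor [e] on [q x] and on [eta]. *)
rewrite linearZ normrM nt mulrC ler_pdivrMr// => /le_trans; apply.
have -> : e / delta * p x = e * (p x / delta) by rewrite mulrAC mulrA.
by rewrite /t; nra.
Qed.

(** A single convex preimage of a ball serves all truncations. Relative openness is checked on one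
    truncation at a time, so [eps], [i] and [theta] may depend on [k]. *)
Lemma bound_localized_continuous (R : realType) (X : tvsType R) (I : Type)
    (p : I -> X -> R) (q : X -> R) (Xs : nat -> set X)
    (f : {linear X -> R^o}) :
  generated_by_seminorms p -> seminorm q -> nondecreasing_seq Xs ->
  (forall k, submod_closed [in Xs k]) ->
  (forall eps : R, 0 < eps -> exists i, exists2 theta : R, 0 < theta &
    forall x, Xs `|Num.ceil eps^-1|%N x ->
      `|f x| <= theta * p i x + eps * q x) ->
  continuous (f : localization (truncations Xs q) -> R^o).
Proof.
move=> p_gen q_semi Xs_nd Xs_sub fX; apply/continuousP => A oA.
rewrite localization_openE => y Ay.
have /nbhs_ballP[r r0 rA] : nbhs (f y : R^o) A by exact: open_nbhs_nbhs.
exists (f @^-1` ball (f y : R^o) r); split.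
- exact: preimage_ball_convex.
- exact: ballxx.
- by move=> z /rA.
move=> _ [k _ <-]; apply: relatively_open_nbhs => u fu [Xu qu].
set s := r - `|f y - f u|.
have s0 : 0 < s by rewrite subr_gt0.
have k1 : 0 < k.+1%:R :> R by rewrite ltr0n.
(* As [q (z - u)] is at most [2 * k.+1], the first entry bounds the [q]-term by [s / 2]; the second
   gives [k.+1 <= eps^-1], so the bound covers [Xs k]. Using [k.+1] avoids dividing by zero at
   [k = 0]. *)
set eps := Num.min (s / (4 * k.+1%:R)) k.+1%:R^-1.
have eps0 : 0 < eps by rewrite lt_min invr_gt0 k1 divr_gt0// mulr_gt0.
have kn : (k <= `|Num.ceil eps^-1|)%N.
  rewrite ltnW// -(ler_nat R) (le_trans _ (le_absz_ceil _))//.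
    by rewrite -[leLHS]invrK lef_pV2 ?posrE ?invr_gt0// ge_min lexx orbT.
  by rewrite invr_ge0 ltW.
have [i [theta theta0 fi]] := fX _ eps0.
(* With this radius the [p]-term is at most [s / 3], and [s / 3 + s / 2] is strictly below the slack
   [s]. *)
have st0 : 0 < s / (3 * theta) by rewrite divr_gt0// mulr_gt0.
apply: filterS (seminorm_ball_nbhs i u p_gen st0) => z /= pz [Xz qz].
have Xzu : Xs `|Num.ceil eps^-1|%N (z - u).
  have /subsetPset := Xs_nd _ _ kn; apply.
  exact: submod_closedB_set.
have {}fi := fi _ Xzu.
have pt : theta * p i (z - u) <= s / 3.
  move: pz; rewrite ler_pdivlMr ?mulr_gt0// => ?.
  by rewrite ler_pdivlMr//; lra.
have qt : eps * q (z - u) <= s / 2.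
  have q2k : q (z - u) <= 2 * k.+1%:R.
    rewrite (le_trans (q_semi.1 _ _))// -scaleN1r q_semi.2 normrN1 mul1r.
    by move: qz qu => /=; rewrite -natr1; lra.
  have es : eps * (4 * k.+1%:R) <= s.
    by rewrite -ler_pdivlMr ?mulr_gt0// ge_min lexx.
  rewrite (le_trans (ler_wpM2l (ltW eps0) q2k))//; lra.
rewrite linearB in fi; rewrite /ball /=.
have -> : f y - f z = (f y - f u) - (f z - f u) by rewrite opprB addrA subrK.
apply: le_lt_trans (ler_normB _ _) _.
have -> : r = s + `|f y - f u| by rewrite subrK.
by lra.
Qed.

Theorem theorem3p6 (R : realType) (X : tvsType R) (I : Type)
    (p : I -> X -> R) (q : X -> R) (Xs : nat -> set X)
    (hausX : hausdorff_space X)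
    (p_gen : generated_by_seminorms p)
    (p_filt : filtering p)
    (q_semi : seminorm q)
    (q_lsc : lower_semicontinuous (fun x : X => (q x)%:E))
    (Xs_nd : nondecreasing_seq Xs)
    (Xs_sub : forall k, submod_closed [in Xs k])
    (Xs_closed : forall k, closed (Xs k))
    (Xs_cover : \bigcup_k Xs k = setT)
    (f : {linear X -> R^o}) :
  [<-> (* (a) *) continuous (f : localization (truncations Xs q) -> R^o);
       (* (b) *) forall eps : R, 0 < eps ->
         exists i, exists2 delta : R, 0 < delta &
         forall x, Xs `|Num.ceil eps^-1|%N x ->
           p i x <= delta -> q x <= eps^-1 -> `|f x| <= eps;
       (* (c) *) forall eps : R, 0 < eps ->
         exists i, exists2 theta : R, 0 < theta &
         forall x, Xs `|Num.ceil eps^-1|%N x ->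
           `|f x| <= theta * p i x + eps * q x].
Proof.
tfae.
- exact: localized_continuous_bound.
(* Capping at 1 meets the condition of [homogeneous_bound]. Passing from [eps] to the smaller [e]
   only raises the index of the subspace, so the bound obtained for [e] still covers the required
   [x]. *)
- move=> fb eps eps0; set e := Num.min 1 eps.
  have e0 : 0 < e by rewrite lt_min ltr01.
  have e1 : e <= 1 by rewrite ge_min lexx.
  have ee : e <= eps by rewrite ge_min lexx orbT.
  have [i [delta delta0 fe]] := fb e e0.
  exists i, (e / delta); first exact: divr_gt0.
  move=> x Xx.
  have {}Xx : Xs `|Num.ceil e^-1|%N x.
    have eV : eps^-1 <= e^-1 by rewrite lef_pV2.
    have eps_ge0 : 0 <= eps^-1 by rewrite invr_ge0 ltW.
    by have /subsetPset := Xs_nd _ _ (absz_ceil_le eps_ge0 eV); apply.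
  have [p_semi _ _] := p_gen.
  apply: le_trans (homogeneous_bound (p_semi i) q_semi (Xs_sub _) e0 e1 delta0 fe Xx) _.
  by rewrite lerD2l ler_wpM2r// seminorm_ge0.
- exact: bound_localized_continuous.
Qed.
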